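(* Let $n \ge 3$ be an odd integer and let $P_n$ be the path on $n$ vertices. Then the detour monophonic vertex cover pebbling number of $P_n$ is $$\mu_{vc}(P_n) = \sum_{i=0}^{\lfloor n/2\rfloor - 1} 2^{2i+1}.$$
   Context: All graphs are finite, simple and connected. A pebbling move removes two pebbles from a vertex and places one pebble on an adjacent vertex (the other pebble is lost). A vertex cover of a graph $G$ is a set $D_{vc}\subseteq V(G)$ such that every edge of $G$ has at least one endpoint in $D_{vc}$. A detour monophonic path between two vertices $x,y$ is a longest chordless (i.e. induced) path between $x$ and $y$. The detour monophonic distance $D_m(x,y)$ is its length (number of edges), so $D_m(x,x)=0$ and $D_m(x,y)=1$ if $x,y$ are adjacent. Pebbles are transported from the source vertex only along detour monophonic paths, so bringing one pebble from a vertex $\dot s$ to a vertex $u$ uses $2^{D_m(\dot s,u)}$ pebbles of $\dot s$ (and a pebble kept on $\dot s$ itself uses one). The detour monophonic vertex cover pebbling number $\mu_{vc}(G)$ is the minimum number $m$ such that, for every choice of source vertex $\dot s\in V(G)$, if $m$ pebbles are placed on $\dot s$, then one can place at least one pebble on every vertex of some minimum-cardinality vertex cover of $G$ by transporting pebbles along detour monophonic paths. Equivalently, $$\mu_{vc}(G)=\max_{\dot s\in V(G)}\ \min_{D}\ \sum_{u\in D}2^{D_m(\dot s,u)},$$ where $D$ ranges over the vertex covers of $G$ of minimum cardinality. *)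

(* Defs.v *)
From mathcomp Require Import all_boot.
From mathcomp Require Import zify.

Set Implicit Arguments.
Unset Strict Implicit.
Unset Printing Implicit Defensive.

Record graph := Graph {
  vertex :> finType;
  edge : rel vertex;
  edge_sym : symmetric edge;
  edge_irrefl : irreflexive edge;
  edge_connected : forall x y : vertex, connect edge x y }.

Section PathGraph.

Variable n : nat.

Definition path_edge : rel 'I_n := fun i j => (i.+1 == j) || (j.+1 == i).

Lemma path_edge_sym : symmetric path_edge.
Proof. by move=> i j; rewrite /path_edge orbC. Qed.

Lemma path_edge_irrefl : irreflexive path_edge.
Proof. by move=> i; rewrite /path_edge orbb; apply/negbTE; lia. Qed.

Lemma path_edge_connected (x y : 'I_n) : connect path_edge x y.
Proof.
have csym : connect_sym path_edge by exact/sym_connect_sym/path_edge_sym.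
have up k (i j : 'I_n) : i + k = j -> connect path_edge i j.
  elim: k i => [|k IHk] i ij.
    by rewrite (_ : i = j) ?connect0 //; apply/val_inj => /=; lia.
  have lt_i1n : i.+1 < n by have := ltn_ord j; lia.
  apply: (@connect_trans _ _ (Ordinal lt_i1n)); last by apply: IHk => /=; lia.
  by apply: connect1; rewrite /path_edge eqxx.
case: (leqP x y) => [/subnKC /up //|/ltnW /subnKC /up].
by rewrite csym.
Qed.

Definition path_graph : graph :=
  Graph path_edge_sym path_edge_irrefl path_edge_connected.

End PathGraph.

Section DetourPebbling.

Variable G : graph.

Definition vertex_cover (D : {set G}) : Prop :=
  forall u v : G, edge u v -> (u \in D) || (v \in D).

Definition min_vertex_cover (D : {set G}) : Prop :=
  vertex_cover D /\ forall D' : {set G}, vertex_cover D' -> #|D| <= #|D'|.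

(* As in mathcomp's [path], the path has vertex sequence [x :: p], hence
   [size p] edges. *)
Definition monophonic_path (x y : G) (p : seq G) : Prop :=
  [/\ path (@edge G) x p, last x p = y, uniq (x :: p) &
      forall i j, i.+1 < j < size (x :: p) ->
        ~~ edge (nth x (x :: p) i) (nth x (x :: p) j)].

Definition detour_monophonic_path (x y : G) (p : seq G) : Prop :=
  monophonic_path x y p /\
  forall q, monophonic_path x y q -> size q <= size p.

Definition config := {ffun G -> nat}.

Definition stack (s : G) (k : nat) : config :=
  [ffun w => if w == s then k else 0].

Definition pebbling_move (u v : G) (c c' : config) : Prop :=
  [/\ edge u v, 2 <= c u &
      c' = [ffun w => if w == u then c w - 2
                      else if w == v then (c w).+1 else c w]].

Inductive pebbling_along (x : G) (p : seq G) : config -> config -> Prop :=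
| PebblingStop c : pebbling_along x p c c
| PebblingStep i c c' c'' :
    i < size p ->
    pebbling_move (nth x (x :: p) i) (nth x (x :: p) i.+1) c c' ->
    pebbling_along x p c' c'' -> pebbling_along x p c c''.

Definition transportable (s u : G) (k : nat) : Prop :=
  exists (p : seq G) (c : config),
    [/\ detour_monophonic_path s u p,
        pebbling_along s p (stack s k) c & 0 < c u].

(* Each target is served by its own share [a u] of the pebbles of [s]: a pebble
   left on the way to one target is not reused for another one, so that covering
   [D] costs the sum over [D] of the individual transport costs. *)
Definition coverable (s : G) (m : nat) (D : {set G}) : Prop :=
  exists a : G -> nat,
    \sum_(u in D) a u <= m /\ forall u, u \in D -> transportable s u (a u).

Definition vc_pebbling_sufficient (m : nat) : Prop :=
  forall s : G, exists D : {set G}, min_vertex_cover D /\ coverable s m D.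

Definition is_detour_vc_pebbling_number (m : nat) : Prop :=
  vc_pebbling_sufficient m /\
  forall m', vc_pebbling_sufficient m' -> m <= m'.

End DetourPebbling.

(* Main.v *)
Require Import Defs.
From mathcomp Require Import all_boot.
From mathcomp Require Import zify.

Set Implicit Arguments.
Unset Strict Implicit.
Unset Printing Implicit Defensive.

(** Write [n = 2k + 1] and number the vertices from [0] to [2k].

    On a path graph a walk without repetition can never turn back, so it is a
    straight segment ([uniq_path_straight]).  The detour monophonic path from
    [s] to [u] is therefore the segment joining them, and a pebble brought from
    [s] to [u] costs exactly [2 ^ |s - u|] ([gap_transportable],
    [transportable_ge]): halving at every edge shows that this many pebbles are
    enough, and they are necessary because giving a pebble at [w] the weight
    [2 ^ (n - |w - u|)] makes the total weight nonincreasing under pebbling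
    moves.

    The pairs [{2i+1, 2i+2}], [i < k], form a matching, so every vertex cover
    picks a vertex from each of them.  Counting shows that the [k] odd vertices
    form a minimum cover, and weighing [u] by its cost [2 ^ u] from the source
    [0] shows that no cover is cheaper from there than the odd vertices
    ([vertex_cover_sum]); this is the lower bound.

    For the upper bound the odd vertices are covered from an arbitrary source
    [s].  Listing those up to [s] from the nearest to the farthest, and then
    those beyond [s], the [i]-th one (from [i = 0]) is at distance at most [2i + 1], so
    the cost is at most its value at the endpoint [0] ([odd_cost_le]). *)

(** * Moving pebbles along a path *)

Section PebblingAlong.

Variables (G : graph) (x : G) (p : seq G).

Lemma pebbling_along_trans c1 c2 c3 :
  pebbling_along x p c1 c2 -> pebbling_along x p c2 c3 ->
  pebbling_along x p c1 c3.
Proof.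
elim=> // i c c' c'' ltip mv _ IH /IH; exact: (PebblingStep ltip mv).
Qed.

Lemma pebbling_along_edge i j (c : config G) :
  path (@edge G) x p -> i < size p -> j * 2 <= c (nth x (x :: p) i) ->
  exists2 c', pebbling_along x p c c' & j <= c' (nth x (x :: p) i.+1).
Proof.
move=> xp ltip.
have e_i : edge (nth x (x :: p) i) (nth x (x :: p) i.+1).
  by move/(pathP x): xp; exact.
set a := nth _ _ i in e_i *; set b := nth _ _ i.+1 in e_i *.
have neq_ba : (b == a) = false.
  by apply/negP => /eqP ba; rewrite ba edge_irrefl in e_i.
suff gain (d : config G) : j * 2 <= d a ->
    exists2 c', pebbling_along x p d c' & d b + j <= c' b.
  move=> /gain[c' cc' le_c']; exists c' => //.
  exact: leq_trans (leq_addl _ _) le_c'.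
elim: j d => [|j IHj] d le_ja.
  by exists d; [exact: PebblingStop | rewrite addn0].
pose d' : config G := [ffun w => if w == a then d w - 2
                                 else if w == b then (d w).+1 else d w].
have mv : pebbling_move a b d d' by split=> //; lia.
have [|c' dc' le_c'] := IHj d'; first by rewrite ffunE eqxx; lia.
exists c'; first exact: PebblingStep ltip mv dc'.
by move: le_c'; rewrite ffunE neq_ba eqxx; lia.
Qed.

(** Each edge halves the number of pebbles that can be carried across it. *)
Lemma pebbling_along_nth i j (c : config G) :
  path (@edge G) x p -> i <= size p -> j * 2 ^ i <= c x ->
  exists2 c', pebbling_along x p c c' & j <= c' (nth x (x :: p) i).
Proof.
move=> xp; elim: i j => [|i IHi] j ltip le_jx.
  by exists c; [exact: PebblingStop | rewrite expn0 muln1 in le_jx].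
have [||c1 cc1 le_c1] := IHi (j * 2); first exact: ltnW.
  by rewrite -mulnA -expnS.
have [c2 c12 le_c2] := pebbling_along_edge xp ltip le_c1.
by exists c2 => //; apply: pebbling_along_trans cc1 c12.
Qed.

Lemma detour_transportable y :
  detour_monophonic_path x y p -> transportable x y (2 ^ size p).
Proof.
move=> dp; have [[xp p_y _ _] _] := dp.
have [||c' cc' c'y] :=
  @pebbling_along_nth (size p) 1 (stack x (2 ^ size p)) xp.
- by [].
- by rewrite ffunE eqxx mul1n.
by exists p, c'; split=> //; rewrite -p_y (last_nth x).
Qed.

(** One move takes two pebbles at a vertex and returns one at a neighbour, so a
    weight that at most doubles across an edge cannot increase in total. *)
Lemma pebbling_along_weight (W : G -> nat) c c' :
    (forall u v, edge u v -> W v <= 2 * W u) -> path (@edge G) x p ->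
  pebbling_along x p c c' -> \sum_w c' w * W w <= \sum_w c w * W w.
Proof.
move=> W_edge xp; elim=> // i d d' d'' ltip [e_i d2 ->] _ /leq_trans; apply.
move: e_i d2; set a := nth _ _ i; set b := nth _ _ i.+1 => e_i d2.
have neq_ba : b != a.
  by apply/eqP => ba; rewrite ba edge_irrefl in e_i.
rewrite (bigD1 a) //= (bigD1 b) //= [leqRHS](bigD1 a) //=
  [X in _ <= _ + X](bigD1 b) //=.
rewrite !ffunE !eqxx (negbTE neq_ba).
rewrite [X in _ + (_ + X)](eq_bigr (fun w => d w * W w)); last first.
  by move=> w /andP[/negbTE wa /negbTE wb]; rewrite ffunE wa wb.
have -> : d a * W a = (d a - 2) * W a + 2 * W a by rewrite -mulnDl subnK.
have := W_edge _ _ e_i; rewrite [(d b).+1 * _]mulSn.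
move: (2 * W a) ((d a - 2) * W a) (d b * W b) => wa r t.
by rewrite -!addnA leq_add2l leq_add2r.
Qed.

End PebblingAlong.

Lemma sum_stack (G : graph) (s : G) k (W : G -> nat) :
  \sum_w stack s k w * W w = k * W s.
Proof.
rewrite (bigD1 s) //= ffunE eqxx big1 ?addn0 // => w /negbTE ws.
by rewrite ffunE ws.
Qed.

(** * Detour paths and transport costs in a path graph *)

(** One of the two truncated differences vanishes: this is [|a - b|]. *)
Definition gap (a b : nat) := (a - b) + (b - a).

Section PathGraphTransport.

Variable n : nat.
Implicit Types x y s u : 'I_n.

(** After a step from [x] to [x + 1] the only neighbour of [x + 1] left is
    [x + 2], so the first step decides the direction of the whole walk. *)
Lemma uniq_path_straight x (p : seq 'I_n) :
  path (@path_edge n) x p -> uniq (x :: p) ->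
  (forall i, i <= size p -> nth x (x :: p) i = x + i :> nat) \/
  (forall i, i <= size p -> nth x (x :: p) i + i = x :> nat).
Proof.
elim: p x => [|y p IHp] x; first by left=> -[|//] _ /=; rewrite addn0.
move=> /= /andP[xy yp] /andP[xNyp Uyp].
have nth_y i : i <= size p -> nth x (y :: p) i = nth y (y :: p) i.
  by move=> leip; apply: set_nth_default.
have no_return : 0 < size p -> nth y (y :: p) 1 <> x :> nat.
  by move=> lt0p /val_inj y1x; case/negP: xNyp; rewrite -y1x mem_nth.
have [xy1|yx1] := orP xy.
  left=> -[|i] leip /=; first by rewrite addn0.
  rewrite nth_y //; have [str|str] := IHp y yp Uyp.
    by rewrite str //; lia.
  by have := str 1; have := str i leip; lia.
right=> -[|i] leip /=; first by rewrite addn0.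
rewrite nth_y //; have [str|str] := IHp y yp Uyp.
  by have := str 1; have := str i leip; lia.
by have := str i leip; lia.
Qed.

Lemma size_uniq_path x (p : seq 'I_n) :
  path (@path_edge n) x p -> uniq (x :: p) -> size p = gap x (last x p).
Proof.
move=> xp Uxp; rewrite (last_nth x) /gap.
by have [str|str] := uniq_path_straight xp Uxp; have := str _ (leqnn _); lia.
Qed.

Lemma uniq_path_monophonic x (p : seq 'I_n) :
  path (@path_edge n) x p -> uniq (x :: p) ->
  monophonic_path (G := path_graph n) x (last x p) p.
Proof.
move=> xp Uxp; split=> // i j /= /andP[ltij ltjp].
rewrite /path_edge.
by have [str|str] := uniq_path_straight xp Uxp;
  have := str i ltac:(lia); have := str j ltac:(lia); lia.
Qed.

Lemma detour_path_exists x y :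
  exists2 p, detour_monophonic_path (G := path_graph n) x y p
           & size p = gap x y.
Proof.
have /connectP[p0 xp0 ->] := path_edge_connected x y.
have [p xp Uxp _] := shortenP xp0.
exists p; last exact: size_uniq_path.
split; first exact: uniq_path_monophonic.
move=> q [xq q_y Uxq _].
by rewrite (size_uniq_path xp Uxp) (size_uniq_path xq Uxq) q_y.
Qed.

(** Moving a pebble across an edge changes its gap to [u] by at most one, so the
    weight [2 ^ (n - gap w u)] at most doubles; one pebble on [u] already weighs
    [2 ^ n]. *)
Lemma transportable_ge s u k :
  transportable (G := path_graph n) s u k -> 2 ^ gap s u <= k.
Proof.
move=> [p [c [[[sp _ _ _] _] skc c_u]]].
(* [n] is an upper bound of all gaps, so this exponent is never truncated *)
pose W (w : path_graph n) := 2 ^ (n - gap w u).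
have gap_n (w : 'I_n) : gap w u <= n.
  by rewrite /gap; have := ltn_ord w; have := ltn_ord u; lia.
have W_edge (v w : path_graph n) : edge v w -> W w <= 2 * W v.
  move=> /= vw; rewrite /W -expnS leq_exp2l //.
  by have := gap_n v; have := gap_n w; move: vw; rewrite /path_edge /gap; lia.
have := pebbling_along_weight W_edge sp skc; rewrite sum_stack => le_W.
have : 2 ^ n <= k * W s.
  apply: leq_trans le_W; rewrite (bigD1 (u : path_graph n)) //=.
  have -> : W u = 2 ^ n by rewrite /W /gap subnn subn0.
  by apply: leq_trans (leq_addr _ _); apply: leq_pmull.
by rewrite -{1}(subnK (gap_n s)) expnD mulnC leq_pmul2r // expn_gt0.
Qed.

Lemma gap_transportable s u :
  transportable (G := path_graph n) s u (2 ^ gap s u).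
Proof.
by have [p dp <-] := detour_path_exists s u; apply: detour_transportable.
Qed.

End PathGraphTransport.

(** * Vertex covers of an odd path *)

Section OddPath.

Variable k : nat.
Let n := k.*2.+1.

Definition odd_vertex (i : 'I_k) : path_graph n := inord (2 * i + 1).

Lemma odd_vertexE i : odd_vertex i = 2 * i + 1 :> nat.
Proof. by rewrite /odd_vertex inordK //; have := ltn_ord i; rewrite /n; lia. Qed.

Lemma odd_vertex_inj : injective odd_vertex.
Proof.
move=> i j /(congr1 (@nat_of_ord n)); rewrite !odd_vertexE => ij.
by apply: val_inj => /=; lia.
Qed.

Definition odd_vertices : {set path_graph n} := [set odd_vertex i | i : 'I_k].

Lemma odd_vertices_cover : vertex_cover odd_vertices.
Proof.
have odd_in (u : path_graph n) : odd u -> u \in odd_vertices.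
  move=> ou; have ltuk : u./2 < k by have := ltn_ord u; rewrite /n; lia.
  apply/imsetP; exists (Ordinal ltuk) => //.
  by apply: val_inj; rewrite /= odd_vertexE /=; lia.
move=> u v /= uv.
have /orP[/odd_in ->|/odd_in ->] : odd u || odd v; rewrite ?orbT //.
by move: uv; rewrite /path_edge; lia.
Qed.

(** A cover meets each edge [{2i+1, 2i+2}] of the matching, and at either
    endpoint the weight is at least [f (2i+1)]. *)
Lemma vertex_cover_sum (D : {set path_graph n}) (f : nat -> nat) :
  {homo f : a b / a <= b} -> vertex_cover D ->
  \sum_(i < k) f (2 * i + 1) <= \sum_(u in D) f u.
Proof.
move=> f_homo Dvc.
pose next (i : 'I_k) : path_graph n := inord (2 * i + 2).
have nextE i : next i = 2 * i + 2 :> nat.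
  by rewrite /next inordK //; have := ltn_ord i; rewrite /n; lia.
pose g i := if odd_vertex i \in D then odd_vertex i else next i.
have gE i : (g i = 2 * i + 1 :> nat) \/ (g i = 2 * i + 2 :> nat).
  by rewrite /g; case: ifP => _; [left; apply: odd_vertexE | right].
have g_inj : injective g.
  move=> i j ij; apply: val_inj => /=.
  by have := gE i; have := gE j; rewrite ij; lia.
have gD : [set g i | i : 'I_k] \subset D.
  apply/subsetP => _ /imsetP[i _ ->]; rewrite /g; case: ifPn => // iND.
  have := Dvc (odd_vertex i) (next i); rewrite (negbTE iND); apply.
  by rewrite /= /path_edge odd_vertexE nextE; lia.
apply: (@leq_trans (\sum_(u in [set g i | i : 'I_k]) f u)).
  rewrite big_imset /=; last by move=> ? ? _ _; apply: g_inj.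
  by apply: leq_sum => i _; apply: f_homo; case: (gE i) => ->; lia.
by rewrite [leqRHS](big_setID [set g i | i : 'I_k]) /= (setIidPr gD) leq_addr.
Qed.

Lemma odd_vertices_min : min_vertex_cover odd_vertices.
Proof.
split; first exact: odd_vertices_cover.
move=> D /(vertex_cover_sum (f := fun=> 1)) le_D.
rewrite card_imset ?card_ord; last exact: odd_vertex_inj.
by rewrite -(sum1_card (mem D)) -[leqLHS](card_ord k) -sum1_card; apply: le_D.
Qed.

(** The odd vertices up to [s] are listed in reverse order: the [i]-th of them
    (from [i = 0]) is at distance [2i] or [2i + 1] from [s].  The later ones are
    no farther from [s] than from [0]. *)
Lemma odd_cost_le s : s < n ->
  \sum_(i < k) 2 ^ gap s (2 * i + 1) <= \sum_(i < k) 2 ^ (2 * i + 1).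
Proof.
move=> ltsn; pose m := uphalf s.
have lemk : m <= k by rewrite /m; move: ltsn; rewrite /n; lia.
rewrite -(big_mkord xpredT (fun i => 2 ^ gap s (2 * i + 1))).
rewrite -(big_mkord xpredT (fun i => 2 ^ (2 * i + 1))).
rewrite !(big_cat_nat (leq0n m) lemk) //=; apply: leq_add.
  rewrite big_nat_rev /= big_nat_cond [leqRHS]big_nat_cond; apply: leq_sum => i.
  by rewrite andbT => /andP[_ ltim]; rewrite leq_exp2l // /gap /m in ltim *; lia.
rewrite big_nat_cond [leqRHS]big_nat_cond; apply: leq_sum => i.
by rewrite andbT => /andP[leim _]; rewrite leq_exp2l // /gap /m in leim *; lia.
Qed.

Lemma odd_path_pebbling_number :
  is_detour_vc_pebbling_number (path_graph n) (\sum_(i < k) 2 ^ (2 * i + 1)).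
Proof.
split=> [s|m suff_m].
  exists odd_vertices; split; first exact: odd_vertices_min.
  exists (fun u : 'I_n => 2 ^ gap s u); split=> [|u _]; last exact: gap_transportable.
  rewrite big_imset /=; last by move=> ? ? _ _; apply: odd_vertex_inj.
  apply: leq_trans (odd_cost_le (ltn_ord s)).
  by apply: leq_sum => i _; rewrite odd_vertexE.
(* the endpoint [0] is the most expensive source *)
have [D [[Dvc _] [a [le_am tr_a]]]] := suff_m (ord0 : 'I_n).
apply: leq_trans le_am.
have exp_homo : {homo expn 2 : a b / a <= b} by move=> ? ? ?; rewrite leq_exp2l.
apply: leq_trans (vertex_cover_sum exp_homo Dvc) _.
apply: leq_sum => u uD; have := transportable_ge (tr_a u uD).
by rewrite /gap /= sub0n subn0.
Qed.

End OddPath.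

Theorem theorem2p1 (n : nat) (hn : 3 <= n) (n_odd : odd n) :
  is_detour_vc_pebbling_number (path_graph n)
    (\sum_(0 <= i < n./2) 2 ^ (2 * i + 1)).
Proof.
rewrite big_mkord; have {1}-> : n = n./2.*2.+1 by lia.
exact: odd_path_pebbling_number.
Qed.
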